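(* Let $\kappa\in\mathbb F_p^\times$, $p>n$ and $0<d(\kappa)<n-1$. Then for any $\ell\in\{1,\dots,d(\kappa)\}$ and $m\in\{1,\dots,d(-\kappa)\}$ we have $$S\big(Q^{mp-1}(-z;-\kappa),\,Q^{\ell p-1}(z;\kappa)\big)=0,$$ where $S$ is the Shapovalov form; that is, $\sum_{a=1}^nQ^{mp-1}_a(-z;-\kappa)\,Q^{\ell p-1}_a(z;\kappa)=0$ as a polynomial in $z=(z_1,\dots,z_n)$.
   Context: $p$ is a prime, $\mathbb K$ a field of characteristic $p$ with prime subfield $\mathbb F_p$, $n>1$ an integer, $z=(z_1,\dots,z_n)$, $-z=(-z_1,\dots,-z_n)$. For $m\ge0$ put $(t;\kappa)_m=\prod_{i=1}^m(t-(i-1)\kappa)$. For every $\kappa\in\mathbb F_p^\times$ let $k=k(\kappa)$ be the integer with $0<k<p$ and $\kappa k\equiv-1\pmod p$ (so $k(-\kappa)=p-k(\kappa)$), and $d(\kappa)=\left[\frac{n\,k(\kappa)}{p}\right]$ (integer part). Put $$\Phi(t,z;\kappa)=\prod_{a=1}^n(t-z_a;\kappa)_{k(\kappa)},\quad \eta_a(t,z)=\frac1{t-z_a}\prod_{j=1}^{a-1}\frac{t-z_j+1}{t-z_j},\quad Q_a(t,z;\kappa)=\Phi(t,z;\kappa)\eta_a(t,z);$$ the $Q_a$ are polynomials in $t,z$. Write $Q(t,z;\kappa)=(Q_1,\dots,Q_n)^\intercal=\sum_iQ^i(z;\kappa)\,(t;\kappa)_i$, where $Q^i(z;\kappa)=(Q^i_1(z;\kappa),\dots,Q^i_n(z;\kappa))^\intercal$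 are vectors of polynomials in $z$. The same definitions with $\kappa$ replaced by $-\kappa$ (hence $k$ replaced by $p-k$, and expansion in the $(t;-\kappa)_i$) give $Q^i(z;-\kappa)$ and $d(-\kappa)=\left[\frac{n(p-k)}{p}\right]$. The Shapovalov form is the symmetric bilinear form $S(x,y)=\sum_{a=1}^nx_ay_a$ on vectors with $n$ coordinates. *)

(* Defs.v *)
From HB Require Import structures.
From mathcomp Require Import all_boot all_order all_algebra.
From mathcomp Require Export mpoly.
Set Implicit Arguments.
Unset Strict Implicit.
Unset Printing Implicit Defensive.
Import GRing.Theory.
Local Open Scope ring_scope.

(* The image of kappa in R through its representative in {0..p-1}; when R has
   characteristic p this is the inclusion of the prime subfield. *)
Definition Fp_incl (R : nzRingType) (p : nat) (kappa : 'F_p) : R :=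
  (kappa : nat)%:R.

(* (x; kappa)_m, with the factors numbered from 0. *)
Definition kpow (R : nzRingType) (x kappa : R) (m : nat) : R :=
  \prod_(i < m) (x - i%:R * kappa).

(* The representative in {0..p-1} of - kappa^-1; see [kval_bounds], [kvalP],
   [kval_uniq] and [kvalN]. *)
Definition kval (p : nat) (kappa : 'F_p) : nat := (- kappa^-1 : 'F_p).

Definition dval (p n : nat) (kappa : 'F_p) : nat := (n * kval kappa) %/ p.

Section Solutions.
Variables (K : fieldType) (n : nat).

(* Polynomials in t with coefficients in K[z_1, ..., z_n]; t is 'X. *)
Local Notation zpoly := {mpoly K[n]}.
Local Notation tzpoly := {poly {mpoly K[n]}}.

Definition tsub (a : 'I_n) : tzpoly := 'X - ('X_a : zpoly)%:P.

Definition Phi (p : nat) (kappa : 'F_p) : tzpoly :=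
  \prod_(a < n) kpow (tsub a) (Fp_incl _ kappa) (kval kappa).

Definition eta (a : 'I_n) : {fraction tzpoly} :=
  1 / FracField.tofrac (tsub a) *
  \prod_(j < n | (j < a)%N)
     (FracField.tofrac (tsub j + 1) / FracField.tofrac (tsub j)).

(* Q_a = Phi * eta_a as a polynomial: the numerator of eta_a times Phi, divided
   by the (monic) denominator of eta_a. The division is exact, see
   [tofrac_Qpoly]. *)
Definition Qpoly (p : nat) (kappa : 'F_p) (a : 'I_n) : tzpoly :=
  (Phi kappa * \prod_(j < n | (j < a)%N) (tsub j + 1)) %/
  (tsub a * \prod_(j < n | (j < a)%N) tsub j).

(* The coefficient of P at (t; kappa)_i in its expansion in the (t; kappa)_j;
   see [kcoef_expansion] and [kcoef_uniq]. *)
Definition kcoef (kappa : zpoly) (P : tzpoly) (i : nat) : zpoly :=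
  (P %/ kpow 'X kappa%:P i).[i%:R * kappa].

Definition Qcoef (p : nat) (kappa : 'F_p) (i : nat) : 'cV[zpoly]_n :=
  \col_(a < n) kcoef (Fp_incl _ kappa) (Qpoly kappa a) i.

(* f(z) |-> f(-z) *)
Definition negz (f : zpoly) : zpoly := f \mPo [tuple - ('X_i : zpoly) | i < n].

End Solutions.

Definition Shapovalov (R : comNzRingType) (n : nat) (x y : 'cV[R]_n) : R :=
  \sum_(a < n) x a 0 * y a 0.

Section Kval.
Variables (p : nat) (p_pr : prime p).
Implicit Types kappa : 'F_p.

Lemma kval_bounds kappa : kappa != 0 -> (0 < kval kappa < p)%N.
Proof.
move=> k0; rewrite /kval; apply/andP; split; last first.
  by have := ltn_ord (- kappa^-1); rewrite [X in (_ < X)%N]Fp_cast.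
rewrite lt0n; apply: contraNneq k0 => v0.
by rewrite -invr_eq0 -oppr_eq0; apply/eqP/val_inj.
Qed.

Lemma kvalP kappa : kappa != 0 -> kappa * (kval kappa)%:R = -1.
Proof. by move=> k0; rewrite natr_Zp mulrN divff. Qed.

Lemma Fp_inclN (R : nzRingType) kappa :
  p \in [pchar R] -> Fp_incl R (- kappa) = - Fp_incl R kappa.
Proof.
move=> pR; apply/eqP; rewrite -addr_eq0 /Fp_incl -natrD -(dvdn_pcharf pR).
rewrite (dvdn_pcharf (pchar_Fp p_pr)) natrD !natr_Zp.
by rewrite addNr.
Qed.

Lemma Fp_incl_kval (R : nzRingType) kappa :
  p \in [pchar R] -> kappa != 0 -> Fp_incl R kappa * (kval kappa)%:R = -1.
Proof.
move=> pR k0; apply/eqP; rewrite -addr_eq0 /Fp_incl -natrM natr1.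
rewrite -(dvdn_pcharf pR) (dvdn_pcharf (pchar_Fp p_pr)) -natr1 natrM.
by rewrite natr_Zp kvalP // addNr.
Qed.

Lemma kval_uniq kappa k :
  (0 < k < p)%N -> kappa * k%:R = -1 -> k = kval kappa.
Proof.
case/andP=> k_gt0 ltkp def_k; have k0 : kappa != 0.
  by apply/eqP=> k0; move/eqP: def_k; rewrite k0 mul0r eq_sym oppr_eq0 oner_eq0.
rewrite /kval -[k](@modn_small k p) // -(val_Fp_nat p_pr); congr val.
by apply: (mulfI k0); rewrite def_k mulrN divff.
Qed.

Lemma kvalN kappa : kappa != 0 -> kval (- kappa) = (p - kval kappa)%N.
Proof.
move=> k0; have /andP[k_gt0 ltkp] := kval_bounds k0.
apply/esym/kval_uniq.
  by rewrite subn_gt0 ltkp /= -subn_gt0 subKn // ltnW.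
rewrite natrB ?(ltnW ltkp) // pchar_Fp_0 // sub0r mulrNN; exact: kvalP.
Qed.

End Kval.

Section Facts.
Variables (K : fieldType) (n : nat).
Local Notation zpoly := {mpoly K[n]}.
Local Notation tzpoly := {poly {mpoly K[n]}}.

Let mulf_cancel (F : fieldType) (a b c : F) :
  a * b != 0 -> c = 1 / a * (c / b) * (a * b).
Proof.
rewrite mulf_eq0 negb_or => /andP[a0 b0].
by rewrite div1r mulrACA mulVf // mul1r divfK.
Qed.

Lemma tofrac_Qpoly (p : nat) (p_pr : prime p) (kappa : 'F_p) (a : 'I_n) :
  kappa != 0 ->
  FracField.tofrac (Qpoly K kappa a) =
  FracField.tofrac (Phi K n kappa) * eta K a.
Proof.
move=> k0; set den := tsub K a * \prod_(j < n | (j < a)%N) tsub K j.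
have den_mon : den \is monic.
  by rewrite /den rpredM ?rpred_prod // => *; rewrite monicXsubC.
have den_unit : lead_coef den \is a GRing.unit by rewrite (monicP den_mon) unitr1.
have dvd_Phi : den %| Phi K n kappa.
  have -> : den = \prod_(j < n | (j <= a)%N) tsub K j.
    rewrite (bigD1 a) //=; congr (_ * _); apply: eq_bigl => j.
    by rewrite ltn_neqAle andbC.
  rewrite /Phi; have /andP[] := kval_bounds p_pr k0.
  case: (kval kappa) => // k _ _.
  under [X in _ %| X]eq_bigr => j _ do
    rewrite /kpow big_ord_recl mul0r subr0.
  rewrite big_split /= [X in _ %| X * _](bigID (fun j : 'I_n => (j <= a)%N)) /=.
  by rewrite -mulrA dvdp_mulIl.
have defQ : Qpoly K kappa a * den =
    Phi K n kappa * \prod_(j < n | (j < a)%N) (tsub K j + 1).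
  by rewrite (Pdiv.IdomainUnit.divpK den_unit) // dvdp_mulr.
have den0 : FracField.tofrac den != 0.
  by rewrite tofrac_eq0 monic_neq0.
apply: (mulIf den0); rewrite -tofracM defQ tofracM -mulrA; congr (_ * _).
rewrite /eta prodf_div -!rmorph_prod /= /den tofracM.
by move: den0; rewrite /den tofracM; apply: mulf_cancel.
Qed.

Lemma monic_kpow (kappa : zpoly) i : kpow 'X kappa%:P i \is monic.
Proof.
apply: rpred_prod => j _.
by rewrite -[j%:R]polyC_natr -polyCM monicXsubC.
Qed.

Lemma size_kpow (kappa : zpoly) i : size (kpow 'X kappa%:P i) = i.+1.
Proof.
rewrite /kpow (eq_bigr (fun j : 'I_i => 'X - (j%:R * kappa)%:P)) => [|j _].
  by rewrite size_prod_XsubC -[in RHS](size_enum_ord i) enumT.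
by rewrite polyCM polyC_natr.
Qed.

Lemma kcoef_kpow (kappa : zpoly) i j :
  kcoef kappa (kpow 'X kappa%:P j) i = (i == j)%:R.
Proof.
rewrite /kcoef; case: ltngtP => [ltij | ltji | ->].
- have -> : kpow 'X kappa%:P j =
      \prod_(i <= l < j) ('X - l%:R * kappa%:P) * kpow 'X kappa%:P i :> tzpoly.
    by rewrite /kpow -!(big_mkord predT (fun l => 'X - l%:R * kappa%:P))
         mulrC -big_cat_nat //= ltnW.
  rewrite Pdiv.IdomainMonic.mulpK ?monic_kpow // big_ltn // hornerM.
  by rewrite -polyC_natr -polyCM hornerXsubC subrr mul0r.
- by rewrite divp_small ?horner0 // !size_kpow ltnS.
- rewrite -[X in X %/ _]mul1r Pdiv.IdomainMonic.mulpK ?monic_kpow //.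
  exact: hornerC.
Qed.

Lemma kcoef_uniq (kappa : zpoly) (c : nat -> zpoly) N i :
  kcoef kappa (\sum_(j < N) c j *: kpow 'X kappa%:P j) i =
  if (i < N)%N then c i else 0.
Proof.
have u : lead_coef (kpow 'X kappa%:P i) \is a GRing.unit.
  by rewrite (monicP (monic_kpow _ _)) unitr1.
have kcoefD P Q : kcoef kappa (P + Q) i = kcoef kappa P i + kcoef kappa Q i.
  by rewrite /kcoef Pdiv.IdomainUnit.divpD // hornerD.
have kcoefZ a P : kcoef kappa (a *: P) i = a * kcoef kappa P i.
  by rewrite /kcoef Pdiv.IdomainUnit.divpZl // hornerZ.
elim: N => [|N IHN]; first by rewrite big_ord0 /kcoef div0p horner0.
rewrite big_ord_recr /= kcoefD IHN kcoefZ kcoef_kpow ltnS.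
by case: (ltngtP i N) => [_|_|->] /=; rewrite ?mulr0 ?addr0 ?mulr1 ?add0r.
Qed.

Lemma kcoef_expansion (kappa : zpoly) (P : tzpoly) N :
  (size P <= N)%N ->
  P = \sum_(i < N) kcoef kappa P i *: kpow 'X kappa%:P i.
Proof.
suffices [c defP] : exists c : nat -> zpoly, (size P <= N)%N ->
    P = \sum_(i < N) c i *: kpow 'X kappa%:P i.
  move=> /defP {}defP; rewrite [LHS]defP; apply: eq_bigr => i _.
  by rewrite defP kcoef_uniq ltn_ord.
elim: N P => [|N IHN] P.
  exists (fun=> 0); rewrite big_ord0 leqn0 size_poly_eq0; exact/eqP.
have [c defP] := IHN (P - P`_N *: kpow 'X kappa%:P N).
exists (fun i => if i == N then P`_N else c i) => sP.
rewrite big_ord_recr /= eqxx -[LHS](subrK (P`_N *: kpow 'X kappa%:P N)).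
congr (_ + _); rewrite {1}defP.
  by apply: eq_bigr => i _; rewrite ltn_eqF.
apply/leq_sizeP => j; rewrite leq_eqVlt coefB coefZ => /predU1P[<- | ltNj].
  have := monicP (monic_kpow kappa N); rewrite lead_coefE size_kpow /= => ->.
  by rewrite mulr1 subrr.
have -> : (kpow 'X kappa%:P N)`_j = 0 by rewrite nth_default ?size_kpow.
by rewrite (nth_default 0 (leq_trans sP ltNj)) mulr0 subrr.
Qed.

End Facts.

(* Main.v *)
Require Import Defs.
From HB Require Import structures.
From mathcomp Require Import all_boot all_order all_algebra.
From mathcomp Require Import finfield ring.
Import GRing.Theory.
Local Open Scope ring_scope.
Set Implicit Arguments.
Unset Strict Implicit.
Unset Printing Implicit Defensive.

(* Let [Phi_a] be [Phi] with [z_1, ..., z_a] shifted by [kappa].  As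
   [k kappa = -1], [(t - z_a) Q_a = Phi_(a-1)] and
   [(t - z_a + 1) Q_a = Phi_a].  Write [Q'_a(u)] and [Phi'_a(u)] for the same
   objects at [-z] and [-kappa].  Since
   [(t - z_a + 1) (u + z_a + 1) - (t - z_a) (u + z_a) = t + u + 1], the sum
   [(t + u + 1) \sum_a Q_a(t) Q'_a(u)] telescopes to
   [Phi_0(t - kappa) Phi'_0(u + kappa) - Phi_0(t) Phi'_0(u)].  The factor
   [t + u + 1] is invariant under [(t, u) |-> (t - kappa, u + kappa)], so
   summing over the [F_p]-translates of [t] and [u] gives
   [\sum_a (\sum_s Q_a(t + s)) (\sum_r Q'_a(u + r)) = 0].  Finally
   [\sum_s Q_a(t + s) = - \sum_l Q_a^(lp-1) (t^p - t)^(l-1)], and the powers of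
   [t^p - t] are independent. *)

(** * Preliminaries on derivatives of products and on [kpow] *)

Lemma deriv_prod_uniq (R : comNzRingType) (I : eqType) (s : seq I)
    (f : I -> {poly R}) : uniq s ->
  (\prod_(i <- s) f i)^`() =
  \sum_(i <- s) (f i)^`() * \prod_(j <- s | j != i) f j.
Proof.
elim: s => [|a s IHs] /=; first by rewrite !big_nil derivC.
case/andP=> a_s s_uniq; rewrite !big_cons derivM eqxx /= IHs //.
congr (_ * _ + _).
  rewrite [RHS]big_seq_cond [LHS]big_seq; apply: eq_bigl => j.
  case j_s: (j \in s) => //=; apply/esym/eqP=> eq_ja.
  by rewrite -eq_ja j_s in a_s.
rewrite big_distrr; apply: eq_big_seq => i i_s /=; rewrite big_cons.
have -> /=: a != i by apply: contraNneq a_s => ->.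
by rewrite mulrCA.
Qed.

Lemma rmorph_kpow (R S : nzRingType) (f : {rmorphism R -> S}) x kappa m :
  f (kpow x kappa m) = kpow (f x) (f kappa) m.
Proof.
rewrite /kpow rmorph_prod; apply: eq_bigr => i _.
by rewrite rmorphB rmorphM rmorph_nat.
Qed.

Lemma rmorph_Fp_incl (R S : nzRingType) (f : {rmorphism R -> S}) p
    (kappa : 'F_p) : f (Fp_incl R kappa) = Fp_incl S kappa.
Proof. exact: rmorph_nat. Qed.

Lemma kpowS (R : nzRingType) (x kappa : R) m :
  kpow x kappa m.+1 = kpow x kappa m * (x - m%:R * kappa).
Proof. by rewrite /kpow big_ord_recr. Qed.

Lemma kpowSl (R : nzRingType) (x kappa : R) m :
  kpow x kappa m.+1 = x * kpow (x - kappa) kappa m.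
Proof.
rewrite /kpow big_ord_recl mul0r subr0; congr (_ * _).
by apply: eq_bigr => i _; rewrite /= -nat1r mulrDl mul1r opprD addrA.
Qed.

(** * The prime field inside a ring of characteristic $p$ *)

Section PrimeField.
Variables (p : nat) (p_pr : prime p) (R : nzRingType) (pR : p \in [pchar R]).
Implicit Types (kappa s : 'F_p) (x : R).

Lemma natr_eqmod m k : m = k %[mod p] -> m%:R = k%:R :> R.
Proof.
have mod_natr i : (i %% p)%:R = i%:R :> R.
  rewrite [in RHS](divn_eq i p) natrD natrM.
  by rewrite (eqP (etrans (esym (dvdn_pcharf pR p)) (dvdnn p))) mulr0 add0r.
by move=> eq_mk; rewrite -mod_natr eq_mk mod_natr.
Qed.

Lemma Fp_inclD kappa s :
  Fp_incl R (kappa + s) = Fp_incl R kappa + Fp_incl R s.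
Proof.
by rewrite /Fp_incl -natrD; apply: natr_eqmod;
  apply: etrans (congr1 (fun q => _ %% q %% p)%N (Fp_cast p_pr)) (modn_mod _ _).
Qed.

Lemma Fp_inclB kappa s :
  Fp_incl R (kappa - s) = Fp_incl R kappa - Fp_incl R s.
Proof. by rewrite Fp_inclD (Fp_inclN p_pr _ pR). Qed.

Lemma Fp_inclM kappa s :
  Fp_incl R (kappa * s) = Fp_incl R kappa * Fp_incl R s.
Proof.
by rewrite /Fp_incl -natrM; apply: natr_eqmod;
  apply: etrans (congr1 (fun q => _ %% q %% p)%N (Fp_cast p_pr)) (modn_mod _ _).
Qed.

End PrimeField.

(** * Products over all $\mathbb F_p$-translates *)

Section FpProduct.
Variables (p : nat) (p_pr : prime p) (R : comNzRingType) (pR : p \in [pchar R]).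
Implicit Types (kappa s : 'F_p) (x y : R).

Definition Fp_prod x : R := \prod_(s : 'F_p) (x - Fp_incl R s).

(** Multiplication by a nonzero [kappa] permutes $\mathbb F_p$. *)
Lemma kpow_Fp kappa x : kappa != 0 -> kpow x (Fp_incl R kappa) p = Fp_prod x.
Proof.
move=> k0; rewrite /Fp_prod (reindex_inj (mulIf k0)) /=.
under eq_bigr => s _ do rewrite (Fp_inclM p_pr pR).
rewrite /kpow /Fp_incl; move: (kappa : nat)%:R => k.
rewrite -!(big_mkord predT (fun i => x - i%:R * k)).
by rewrite (Fp_cast p_pr).
Qed.

(** Each block of $p$ consecutive factors is a full product over $\mathbb F_p$, and the numbering of
    the factors restarts after it because $p = 0$ in [R]. *)
Lemma kpow_modp kappa x l m : kappa != 0 ->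
  kpow x (Fp_incl R kappa) (l * p + m) =
  Fp_prod x ^+ l * kpow x (Fp_incl R kappa) m.
Proof.
move=> k0; elim: l => [|l IHl]; first by rewrite mul0n expr0 mul1r.
rewrite mulSn -addnA {1}/kpow big_split_ord /= -/(kpow _ _ p) kpow_Fp //.
rewrite exprS -mulrA -IHl; congr (_ * _); apply: eq_bigr => i _.
by rewrite natrD (pcharf0 pR) add0r.
Qed.

Lemma Fp_prod_shift x s : Fp_prod (x + Fp_incl R s) = Fp_prod x.
Proof.
rewrite /Fp_prod (reindex_inj (addIr s)); apply: eq_bigr => i _ /=.
by rewrite (Fp_inclD p_pr pR) [- _]opprD addrACA subrr addr0.
Qed.

End FpProduct.

(** * Sums over $\mathbb F_p$-translates of polynomials in one variable *)

Section FpTrace.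
Variables (p : nat) (p_pr : prime p) (R : idomainType) (pR : p \in [pchar R]).
Variables (kappa : 'F_p) (kappa_neq0 : kappa != 0).

Let p_polyR : p \in [pchar {poly R}]. Proof. by rewrite pchar_poly. Qed.

Local Notation T := (Fp_prod p ('X : {poly R})).
Local Notation k := (Fp_incl {poly R} kappa).

Lemma Fp_incl_polyC s : Fp_incl {poly R} (s : 'F_p) = (Fp_incl R s)%:P.
Proof. by rewrite (rmorph_Fp_incl polyC). Qed.

Lemma size_Fp_prod : (1 < size T)%N.
Proof.
rewrite /Fp_prod; under eq_bigr => s _ do rewrite Fp_incl_polyC.
rewrite size_prod_XsubC ltnS lt0n size_eq0; apply/eqP=> no_s.
by have := mem_index_enum (0 : 'F_p); rewrite no_s.
Qed.

(** This is the factorization of $X^p - X$ over $\mathbb F_p$, carried to [R] by [Fp_incl], which is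
    a ring morphism since [R] has characteristic $p$. *)
Lemma Fp_prodE : T = 'X^p - 'X.
Proof.
have incl_zmod : zmod_morphism (@Fp_incl R p).
  by move=> x y; rewrite (Fp_inclB p_pr pR).
have incl_monoid : monoid_morphism (@Fp_incl R p).
  by split; [exact: mulr1n | move=> x y; rewrite (Fp_inclM p_pr pR)].
have [f fE] : exists f : {rmorphism 'F_p -> R}, f =1 @Fp_incl R p.
  pose f : {rmorphism 'F_p -> R} := HB.pack (@Fp_incl R p)
    (GRing.isZmodMorphism.Build _ _ _ incl_zmod)
    (GRing.isMonoidMorphism.Build _ _ _ incl_monoid).
  by exists f.
have := congr1 (map_poly f) (finField_genPoly 'F_p).
rewrite card_Fp // rmorphB rmorph_prod /= map_polyXn map_polyX => ->.
apply: eq_bigr => s _.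
by rewrite rmorphB /= map_polyX map_polyC /= fE Fp_incl_polyC.
Qed.

(* [(X; kappa)_(p-1)] is [T / (X + kappa)], so its translates sum to the
   derivative of [T = X^p - X]. *)
Lemma sum_kpow_pred : \sum_(s : 'F_p) kpow ('X + Fp_incl _ s) k p.-1 = -1.
Proof.
have pred_natr (S : nzRingType) : p \in [pchar S] -> p.-1%:R = -1 :> S.
  move=> pS; apply/eqP.
  by rewrite -addr_eq0 natr1 prednK ?prime_gt0 // (pcharf0 pS).
have kpow_pred : kpow 'X k p.-1 =
    \prod_(i : 'F_p | i != - kappa) ('X - Fp_incl _ i).
  apply: (@mulIf _ ('X + k)).
    by rewrite Fp_incl_polyC monic_neq0 ?monicXaddC.
  have := kpowS ('X : {poly R}) k p.-1.
  rewrite prednK ?prime_gt0 // (kpow_Fp p_pr p_polyR _ kappa_neq0).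
  rewrite pred_natr // mulN1r opprK => <-.
  rewrite /Fp_prod (bigD1 (- kappa)) //= mulrC; congr (_ * _).
  by rewrite (Fp_inclN p_pr _ p_polyR) opprK.
have <- : T^`() = -1.
  by rewrite Fp_prodE derivB derivXn derivX mulrn_pchar ?sub0r.
rewrite /Fp_prod deriv_prod_uniq ?index_enum_uniq //.
(* The translate by [s] is [T] without the factor whose root is [- (kappa + s)], that is, the term
   of the derivative with that index. *)
rewrite [RHS](reindex_inj (inj_comp oppr_inj (addrI kappa))) /=.
apply: eq_bigr => s _.
rewrite [in RHS]Fp_incl_polyC derivXsubC mul1r.
have -> : kpow ('X + Fp_incl {poly R} s) k p.-1 =
    kpow 'X k p.-1 \Po ('X + Fp_incl {poly R} s).
  rewrite [RHS](rmorph_kpow (comp_poly _)) /= comp_polyX.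
  by rewrite (rmorph_Fp_incl (comp_poly _)).
rewrite kpow_pred rmorph_prod /= [LHS](reindex_inj (addIr s)).
apply: eq_big => [i|i _]; first by rewrite opprD -subr_eq opprK.
rewrite rmorphB /= comp_polyX (rmorph_Fp_incl (comp_poly _)).
by rewrite (Fp_inclD p_pr p_polyR) [- _]opprD addrACA subrr addr0.
Qed.

(* [(x; kappa)_m] is [((m+1) kappa)^-1] times the [kappa]-difference of
   [(x; kappa)_(m+1)]. *)
Lemma sum_kpow_lt m : (m < p.-1)%N ->
  \sum_(s : 'F_p) kpow ('X + Fp_incl _ s) k m = 0.
Proof.
rewrite -ltnS prednK ?prime_gt0 // => ltmp.
have k0 : k != 0.
  apply: contraTneq isT => k0; have := Fp_incl_kval p_pr p_polyR kappa_neq0.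
  by rewrite k0 mul0r => /esym/eqP; rewrite oppr_eq0 oner_eq0.
have mk0 : m.+1%:R * k != 0.
  by rewrite mulf_neq0 // -(dvdn_pcharf p_polyR) gtnNdvd.
apply: (mulfI mk0); rewrite mulr0 big_distrr /=.
under eq_bigr => s _.
  have -> : m.+1%:R * k * kpow ('X + Fp_incl _ s) k m =
      kpow ('X + Fp_incl _ (s + kappa)) k m.+1 - kpow ('X + Fp_incl _ s) k m.+1.
    rewrite kpowSl kpowS (Fp_inclD p_pr p_polyR) addrA addrK -natr1; ring.
  over.
rewrite sumrB (reindex_inj (addIr (- kappa))) /=.
by under eq_bigr => s _ do rewrite subrK; rewrite subrr.
Qed.

(** For $i = qp + m$ with $m < p$, the factor $T^q$ of $(X;\kappa)_i$ is translation invariant, so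
    the sum over translates is $-T^q$ if $m = p-1$ and $0$ otherwise. Taking [M * p] terms makes all
    blocks complete. *)
Lemma sum_shift_kpow (c : nat -> R) M :
  \sum_(s : 'F_p)
    ((\sum_(i < M * p) c i *: kpow 'X k i) \Po ('X + Fp_incl _ s)) =
  - ((\poly_(l < M) c (l * p + p.-1)%N) \Po T).
Proof.
pose g m := \sum_(s : 'F_p) kpow ('X + Fp_incl _ s) k m.
have gE m q : (m < p)%N -> g (q * p + m)%N = - ((m == p.-1)%:R * T ^+ q).
  move=> ltmp; rewrite /g; under eq_bigr => s _.
    by rewrite kpow_modp // Fp_prod_shift //; over.
  rewrite -big_distrr /=; case: eqP => [-> | /eqP m_neq].
    by rewrite sum_kpow_pred mulrN mulr1 mul1r.
  rewrite sum_kpow_lt ?mulr0 ?mul0r ?oppr0 //.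
  by rewrite ltn_neqAle m_neq -ltnS prednK ?prime_gt0.
transitivity (\sum_(i < M * p) c i *: g i).
  under eq_bigr => s _ do rewrite rmorph_sum /=.
  rewrite exchange_big; apply: eq_bigr => i _ /=; rewrite scaler_sumr.
  apply: eq_bigr => s _; rewrite comp_polyZ (rmorph_kpow (comp_poly _)) /=.
  by rewrite comp_polyX (rmorph_Fp_incl (comp_poly _)).
rewrite poly_def rmorph_sum /= -sumrN.
elim: M => [|M IHM]; first by rewrite mul0n !big_ord0.
rewrite mulSnr big_split_ord /= IHM big_ord_recr /=; congr (_ + _).
have lt_pred : (p.-1 < p)%N by rewrite prednK ?prime_gt0.
rewrite (bigD1 (Ordinal lt_pred)) //= gE // eqxx mul1r big1 ?addr0.
  by rewrite comp_polyZ rmorphXn /= comp_polyX scalerN.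
move=> i; rewrite -val_eqE /= => /negPf i_neq.
by rewrite gE // i_neq mul0r oppr0 scaler0.
Qed.

End FpTrace.

(** * Partially shifted master functions and the telescoping identity *)

Section MasterFunction.
Variables (R : comNzRingType) (n : nat).
Implicit Types (z : 'I_n -> R) (kappa x : R) (k a : nat).

(* [Phi_a]: the shifted variables are those with (0-based) index below [a]. *)
Definition master z kappa k a x : R :=
  \prod_(j < n) kpow (x - z j - (j < a)%:R * kappa) kappa k.

(* [Q_a] without division: in [Phi_(a-1) / (t - z_a)] the denominator cancels
   the first factor of [(t - z_a; kappa)_k]. *)
Definition qvalue z kappa k (a : 'I_n) x : R :=
  (\prod_(j < n | j != a) kpow (x - z j - (j < a)%:R * kappa) kappa k) *
  kpow (x - z a - kappa) kappa k.-1.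

Lemma qvalue_master z kappa k (a : 'I_n) x : (0 < k)%N ->
  qvalue z kappa k a x * (x - z a) = master z kappa k a x.
Proof.
case: k => // k _; rewrite /qvalue /master [RHS](bigD1 a) //= ltnn mul0r subr0.
by rewrite [in RHS]kpowSl -mulrA mulrC [kpow _ _ _ * _]mulrC.
Qed.

Lemma qvalue_masterS z kappa k (a : 'I_n) x : (0 < k)%N -> kappa * k%:R = -1 ->
  qvalue z kappa k a x * (x - z a + 1) = master z kappa k a.+1 x.
Proof.
case: k => // k _ def_k; rewrite /qvalue /master [RHS](bigD1 a) //= ltnSn mul1r.
(* Here $\kappa(k+1) = -1$, so $x - z_a + 1$ is exactly the factor that extends
   [kpow (x - z a - kappa) kappa k] to length [k.+1]. *)
have -> : x - z a + 1 = x - z a - kappa - k%:R * kappa.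
  move: def_k; rewrite -natr1 mulrDr mulr1 => /(canRL (addrK _)).
  by rewrite [_%:R * _]mulrC => ->; ring.
rewrite [in RHS]kpowS [RHS]mulrC -mulrA; congr (_ * _).
apply: eq_bigr => j j_neq.
by rewrite ltnS [(j <= a)%N]leq_eqVlt val_eqE (negPf j_neq).
Qed.

Lemma master0 z kappa k x :
  master z kappa k 0 x = \prod_(j < n) kpow (x - z j) kappa k.
Proof. by apply: eq_bigr => j _; rewrite mul0r subr0. Qed.

Lemma master_last z kappa k x :
  master z kappa k n x = master z kappa k 0 (x - kappa).
Proof.
by rewrite master0; apply: eq_bigr => j _; rewrite ltn_ord mul1r addrAC.
Qed.

Lemma sum_qvalueM z kappa k k' x u :
    (0 < k)%N -> (0 < k')%N -> kappa * k%:R = -1 -> - kappa * k'%:R = -1 ->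
  (x + u + 1) * (\sum_(a < n) qvalue (fun j => - z j) (- kappa) k' a u *
                              qvalue z kappa k a x) =
  master (fun j => - z j) (- kappa) k' 0 (u + kappa) *
    master z kappa k 0 (x - kappa) -
  master (fun j => - z j) (- kappa) k' 0 u * master z kappa k 0 x.
Proof.
move=> k_gt0 k'_gt0 def_k def_k'.
(* Writing $u + \kappa$ as $u - (-\kappa)$ lets [master_last] apply to the factor with step
   $-\kappa$ as well. *)
rewrite -[u + kappa](congr1 (fun y => u + y) (opprK kappa)) -!master_last.
pose F a := master (fun j => - z j) (- kappa) k' a u * master z kappa k a x.
rewrite -[RHS](@telescope_sumr _ 0 n F) // big_mkord big_distrr.
apply: eq_bigr => a _ /=; rewrite /F -!qvalue_master // -!qvalue_masterS //.
ring.
Qed.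

End MasterFunction.

(** * Orthogonality of the sums over translates *)

Lemma rmorph_qvalue (R S : comNzRingType) (f : {rmorphism R -> S}) n
    (z : 'I_n -> R) kappa k a x :
  f (qvalue z kappa k a x) = qvalue (fun j => f (z j)) (f kappa) k a (f x).
Proof.
rewrite /qvalue rmorphM rmorph_prod rmorph_kpow !rmorphB; congr (_ * _).
by apply: eq_bigr => j _; rewrite rmorph_kpow !rmorphB rmorphM rmorph_nat.
Qed.

Lemma sum_shifts_qvalueM p (p_pr : prime p) (R : idomainType)
    (pR : p \in [pchar R]) n (z : 'I_n -> R) (kappa : 'F_p) (x u : R) :
    kappa != 0 -> (forall s : 'F_p, x + u + Fp_incl R s != 0) ->
  \sum_(a < n)
    (\sum_(s : 'F_p) qvalue (fun j => - z j) (Fp_incl R (- kappa))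
       (kval (- kappa)) a (u + Fp_incl R s)) *
    (\sum_(s : 'F_p) qvalue z (Fp_incl R kappa)
       (kval kappa) a (x + Fp_incl R s)) = 0.
Proof.
move=> k0 xu0; have Nk0 : - kappa != 0 by rewrite oppr_eq0.
have /andP[k_gt0 _] := kval_bounds p_pr k0.
have /andP[k'_gt0 _] := kval_bounds p_pr Nk0.
have def_k := Fp_incl_kval p_pr pR k0; have := Fp_incl_kval p_pr pR Nk0.
rewrite (Fp_inclN p_pr _ pR); set k' := kval (- kappa) in k'_gt0 *.
set k := kval kappa in k_gt0 def_k *.
set kap := Fp_incl R kappa in def_k * => def_k'.
(* The double sum is grouped by the total shift [c]: the shifts of [x] and [u] become [s] and
   [c - s]. For fixed [c] the factor $x + u + c + 1$ does not depend on [s] and can be cancelled. *)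
under eq_bigr => a _.
  rewrite big_distrlr /= exchange_big /=.
  under eq_bigr => s _ do rewrite (reindex_inj (addIr (- s))) /=.
  over.
rewrite exchange_big /=; under eq_bigr => s _ do rewrite exchange_big /=.
rewrite exchange_big /= big1 // => c _; apply: (mulfI (xu0 (c + 1))).
rewrite mulr0 big_distrr /=.
pose H s := master (fun j => - z j) (- kap) k' 0 (u + Fp_incl R (c - s)) *
            master z kap k 0 (x + Fp_incl R s).
(* Moving $\kappa$ from [x] to [u] is the change of [s] into [s - kappa], so the boundary terms
   cancel around $\mathbb F_p$. *)
transitivity (\sum_(s : 'F_p) (H (s - kappa) - H s)).
  apply: eq_bigr => s _.
  have -> : x + u + Fp_incl R (c + 1) =
      (x + Fp_incl R s) + (u + Fp_incl R (c - s)) + 1.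
    by rewrite (Fp_inclD p_pr pR) (Fp_inclB p_pr pR) [Fp_incl R 1]mulr1n; ring.
  rewrite sum_qvalueM // /H opprB addrCA addrC (Fp_inclD p_pr pR (c - s)) addrA.
  by rewrite (Fp_inclB p_pr pR s) addrA.
by rewrite sumrB [X in _ - X](reindex_inj (addIr (- kappa))) subrr.
Qed.

(** * From the polynomials [Qpoly] to orthogonality of their coefficients *)

Lemma Qpoly_qvalue (K : fieldType) (n p : nat) (p_pr : prime p)
    (pK : p \in [pchar K]) (kappa : 'F_p) (a : 'I_n) : kappa != 0 ->
  Qpoly K kappa a =
  qvalue (fun j => ('X_j : {mpoly K[n]})%:P) (Fp_incl _ kappa) (kval kappa)
    a 'X.
Proof.
move=> k0; have /andP[k_gt0 _] := kval_bounds p_pr k0.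
have pA : p \in [pchar {poly {mpoly K[n]}}].
  by rewrite pchar_poly (rmorph_pchar (@mpolyC n K)).
have def_k := Fp_incl_kval p_pr pA k0.
rewrite /Qpoly; set den := _ * \prod_(j < n | _) tsub K j.
have den_mon : den \is monic.
  by rewrite /den rpredM ?rpred_prod // => *; rewrite monicXsubC.
rewrite -[RHS](Pdiv.IdomainMonic.mulpK den_mon); congr (_ %/ _).
rewrite /den mulrA qvalue_master // /Phi /master.
rewrite !(big_mkcond (fun j : 'I_n => (j < a)%N)).
rewrite -!big_split; apply: eq_bigr => j _ /=; rewrite -/(tsub K j).
case: ifP => _; last by rewrite mul0r subr0.
(* For [j < a] both sides are $(t - z_j;\kappa)_{k+1}$, with the last factor $t - z_j + 1$ split off
   on the left and the first factor $t - z_j$ on the right. *)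
rewrite mul1r [RHS]mulrC -kpowSl kpowS; congr (_ * (_ + _)).
by rewrite mulrC def_k opprK.
Qed.

HB.instance Definition _ (K : fieldType) (n : nat) :=
  GRing.RMorphism.copy (@negz K n)
    (comp_mpoly [tuple - ('X_i : {mpoly K[n]}) | i < n]).

Lemma negz_var (K : fieldType) n (i : 'I_n) :
  negz ('X_i : {mpoly K[n]}) = - 'X_i.
Proof. by rewrite /negz comp_mpolyXU -tnth_nth tnth_mktuple. Qed.

(** The outer variable carries [P] and the inner one [Q]. Composition with the nonconstant [T] is
    injective, so [T] is removed from the outer variable, the coefficient [i] is taken, and the same
    is done in the inner variable. *)
Lemma comp_poly_inner_product (R : idomainType) (I : finType)
    (P Q : I -> {poly R}) (T : {poly R}) i j : (1 < size T)%N ->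
  \sum_a map_poly polyC (P a \Po T) * (Q a \Po T)%:P = 0 ->
  \sum_a (P a)`_i * (Q a)`_j = 0.
Proof.
move=> T_gt1 PQ0.
have {}PQ0 : \sum_a map_poly polyC (P a) * (Q a \Po T)%:P = 0.
  apply/eqP; rewrite -(@comp_poly_eq0 _ _ (map_poly polyC T)); last first.
    by rewrite size_map_inj_poly //; exact: polyC_inj.
  rewrite rmorph_sum -[X in _ == X]PQ0 /=; apply/eqP/eq_bigr => a _.
  by rewrite rmorphM /= comp_polyC map_comp_poly.
have {}PQ0 : \sum_a (P a)`_i *: Q a = 0.
  apply/eqP; rewrite -(comp_poly_eq0 _ T_gt1) rmorph_sum /=.
  apply/eqP; transitivity ((0 : {poly {poly R}})`_i); last by rewrite coef0.
  rewrite -PQ0 coef_sum; apply: eq_bigr => a _.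
  by rewrite coefMC coef_map comp_polyZ mul_polyC.
transitivity ((0 : {poly R})`_j); last by rewrite coef0.
by rewrite -PQ0 coef_sum; apply: eq_bigr => a _; rewrite coefZ.
Qed.

Theorem theorem1p3 (p : nat) (p_pr : prime p)
    (K : fieldType) (K_char : p \in [pchar K])
    (n : nat) (n_gt1 : (1 < n)%N)
    (kappa : 'F_p) (kappa_neq0 : kappa != 0)
    (n_lt_p : (n < p)%N) (d_bounds : (0 < dval n kappa < n - 1)%N)
    (l m : nat)
    (l_bounds : (1 <= l <= dval n kappa)%N)
    (m_bounds : (1 <= m <= dval n (- kappa))%N) :
  Shapovalov
    (map_mx (@negz K n) (Qcoef K n (- kappa) (m * p - 1)))
    (Qcoef K n kappa (l * p - 1)) = 0.
Proof.
have Nkappa_neq0 : - kappa != 0 by rewrite oppr_eq0.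
pose A : idomainType := {mpoly K[n]}.
have pA : p \in [pchar A] by rewrite (rmorph_pchar (@mpolyC n K)).
have pAt : p \in [pchar {poly A}] by rewrite pchar_poly.
have pAtu : p \in [pchar {poly {poly A}}] by rewrite pchar_poly.
pose c a := kcoef (Fp_incl A kappa) (Qpoly K kappa a).
pose c' a i := negz (kcoef (Fp_incl A (- kappa)) (Qpoly K (- kappa) a) i).
(* [M] bounds the sizes of all polynomials involved; the summands [l] and [m] place the indices
   [l.-1] and [m.-1] below [M]. *)
pose M := (\max_a size (Qpoly K kappa a : {poly A}) +
           \max_a size (Qpoly K (- kappa) a : {poly A}) + l + m)%N.
pose E a : {poly A} := \poly_(q < M) c a (q * p + p.-1)%N.
pose E' a : {poly A} := \poly_(q < M) c' a (q * p + p.-1)%N.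
pose T := Fp_prod p ('X : {poly A}).
have defQ (kap : 'F_p) a : (size (Qpoly K kap a : {poly A}) <= M)%N ->
    Qpoly K kap a = \sum_(i < M * p) kcoef (Fp_incl A kap) (Qpoly K kap a) i *:
                      kpow 'X (Fp_incl {poly A} kap) i.
  move=> leM; rewrite -(rmorph_Fp_incl polyC); apply: kcoef_expansion.
  by rewrite (leq_trans leM) // leq_pmulr ?prime_gt0.
have sumQ a : \sum_(s : 'F_p) qvalue (fun j => ('X_j : A)%:P)
    (Fp_incl {poly A} kappa) (kval kappa) a ('X + Fp_incl _ s) = - (E a \Po T).
  rewrite -(sum_shift_kpow p_pr pA kappa_neq0) -defQ; last first.
    by rewrite /M -!addnA (leq_trans _ (leq_addr _ _)) // leq_bigmax.
  apply: eq_bigr => s _.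
  rewrite Qpoly_qvalue // (rmorph_qvalue (comp_poly _)) /=.
  rewrite comp_polyX (rmorph_Fp_incl (comp_poly _)).
  by congr (_ * _); [apply: eq_bigr => j _|]; rewrite comp_polyC.
have sumQ' a : \sum_(s : 'F_p) qvalue (fun j => - ('X_j : A)%:P)
    (Fp_incl {poly A} (- kappa)) (kval (- kappa)) a ('X + Fp_incl _ s) =
    - (E' a \Po T).
  rewrite -(sum_shift_kpow p_pr pA Nkappa_neq0).
  (* [negz] fixes the images of $\mathbb F_p$, so applied coefficientwise it fixes the basis
     $(t;-\kappa)_i$ and acts only on the coefficients. *)
  have -> : \sum_(i < M * p) c' a i *: kpow 'X (Fp_incl {poly A} (- kappa)) i =
      map_poly (@negz K n) (Qpoly K (- kappa) a).
    rewrite [in RHS]defQ; last first.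
      by rewrite /M -!addnA addnCA (leq_trans _ (leq_addr _ _)) // leq_bigmax.
    rewrite rmorph_sum /=; apply: eq_bigr => i _.
    by rewrite map_polyZ rmorph_kpow /= map_polyX rmorph_Fp_incl.
  apply: eq_bigr => s _; rewrite Qpoly_qvalue // (rmorph_qvalue (map_poly _)).
  rewrite (rmorph_qvalue (comp_poly _)) /= map_polyX comp_polyX.
  rewrite !rmorph_Fp_incl.
  by congr (_ * _); [apply: eq_bigr => j _|];
    rewrite map_polyC comp_polyC /= negz_var polyCN.
(* The variable $t$ of $Q$ is the inner ['X%:P] and that of $Q'$ the outer ['X]; the sum is monic in
   the latter. *)
have xu_neq0 (s : 'F_p) :
    'X%:P + 'X + Fp_incl {poly {poly A}} s != 0.
  rewrite -addrA addrCA (Fp_incl_polyC _ s) -polyCD.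
  by rewrite monic_neq0 ?monicXaddC.
have := sum_shifts_qvalueM p_pr pAtu (fun j : 'I_n => ('X_j : A)%:P%:P)
          kappa_neq0 xu_neq0.
under eq_bigr => a _.
  have -> : \sum_(s : 'F_p) qvalue (fun j => - ('X_j : A)%:P%:P)
      (Fp_incl {poly {poly A}} (- kappa)) (kval (- kappa)) a
      ('X + Fp_incl _ s) = - map_poly polyC (E' a \Po T).
    rewrite -rmorphN -sumQ' rmorph_sum /=; apply: eq_bigr => s _.
    rewrite (rmorph_qvalue (map_poly _)) rmorphD /= map_polyX !rmorph_Fp_incl.
    by congr (_ * _); [apply: eq_bigr => j _|]; rewrite rmorphN /= map_polyC.
  have -> : \sum_(s : 'F_p) qvalue (fun j => ('X_j : A)%:P%:P)
      (Fp_incl {poly {poly A}} kappa) (kval kappa) a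
      ('X%:P + Fp_incl _ s) = - (E a \Po T)%:P.
    rewrite -rmorphN -sumQ rmorph_sum /=; apply: eq_bigr => s _.
    by rewrite (rmorph_qvalue polyC) rmorphD /= !(rmorph_Fp_incl polyC).
  rewrite mulrNN.
  over.
move/(comp_poly_inner_product m.-1 l.-1 (size_Fp_prod p A)) => EE'0.
(* Powers of [T] are numbered from 0, so $Q^{\ell p-1}$ sits at the power $\ell - 1$. *)
have pred_mulp q : (0 < q)%N -> (q.-1 * p + p.-1 = q * p - 1)%N.
  by case: q => // q _ /=; rewrite mulSnr -[p.-1]subn1 addnBA ?prime_gt0.
have /andP[l_gt0 _] := l_bounds; have /andP[m_gt0 _] := m_bounds.
have lt_mM : (m.-1 < M)%N by rewrite prednK // leq_addl.
have lt_lM : (l.-1 < M)%N by rewrite prednK // /M addnAC leq_addl.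
apply: etrans EE'0; apply: eq_bigr => a _.
by rewrite !mxE !coef_poly lt_mM lt_lM !pred_mulp.
Qed.
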